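(* Let $$G=\langle a,t,s\mid tat^{-1}=a^n,\ sas^{-1}=a^m,\ tst^{-1}s^{-1}=a^r\rangle$$ for some coprime integers $n,m\ge 2$ and some $r\in\mathbb{Z}$. Then $G$ has property $R_\infty$.
   Context: A group $G$ has property $R_\infty$ if for every $\varphi\in\mathrm{Aut}(G)$ the number $R(\varphi)$ of equivalence classes of the relation on $G$ given by $g\sim h\iff zg\varphi(z)^{-1}=h$ for some $z\in G$ is infinite. *)

(* Defs.v *)
From HB Require Import structures.
From mathcomp Require Import all_boot all_order all_algebra.
From mathcomp Require Import boolp classical_sets functions cardinality.

Set Implicit Arguments.
Unset Strict Implicit.
Unset Printing Implicit Defensive.

Local Open Scope group_scope.
Local Open Scope quotient_scope.

Section Words.
Variable X : choiceType.

(* The letter (x, false) stands for x and (x, true) for its inverse; words are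
   not required to be reduced. *)
Definition word : Type := seq (X * bool).
HB.instance Definition _ := Choice.on word.

Definition letter (x : X) : word := [:: (x, false)].
Definition winv (u : word) : word := rev [seq (l.1, ~~ l.2) | l <- u].

Lemma winvK : involutive winv.
Proof.
move=> u; rewrite /winv map_rev revK -map_comp -[RHS]map_id.
by apply: eq_map => -[x b] /=; rewrite negbK.
Qed.

Lemma winvM (u v : word) : winv (u ++ v) = winv v ++ winv u.
Proof. by rewrite /winv map_cat rev_cat. Qed.

Lemma cat_wordA : associative (fun u v : word => u ++ v).
Proof. exact: catA. Qed.

Lemma cat_word1 : left_id ([::] : word) (fun u v : word => u ++ v).
Proof. by []. Qed.

HB.instance Definition _ :=
  isStarMonoid.Build word cat_wordA cat_word1 winvK winvM.

(* Each pair (u, v) of rels is a relation u = v. *)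
Variable rels : seq (word * word).

(* The least congruence containing rels whose quotient is a group: this is
   equality in the free group on X modulo the normal closure of the words
   u v^-1 for (u, v) in rels. *)
Inductive pres_eq : word -> word -> Prop :=
| pres_eq_rel u v : (u, v) \in rels -> pres_eq u v
| pres_eq_inv u : pres_eq (u * u^-1) 1
| pres_eq_mul u u' v v' : pres_eq u u' -> pres_eq v v' ->
    pres_eq (u * v) (u' * v')
| pres_eq_refl u : pres_eq u u
| pres_eq_sym u v : pres_eq u v -> pres_eq v u
| pres_eq_trans u v w : pres_eq u v -> pres_eq v w -> pres_eq u w.

Definition pres_eqb (u v : word) : bool := `[< pres_eq u v >].

Lemma pres_eqb_refl : reflexive pres_eqb.
Proof. by move=> u; apply/asboolP; apply: pres_eq_refl. Qed.

Lemma pres_eqb_sym : symmetric pres_eqb.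
Proof. by move=> u v; apply/asboolP/asboolP; apply: pres_eq_sym. Qed.

Lemma pres_eqb_trans : transitive pres_eqb.
Proof.
by move=> v u w /asboolP uv /asboolP vw; apply/asboolP; apply: pres_eq_trans vw.
Qed.

Canonical pres_equiv :=
  EquivRel pres_eqb pres_eqb_refl pres_eqb_sym pres_eqb_trans.

Lemma pres_eq_winv u v : pres_eq u v -> pres_eq u^-1 v^-1.
Proof.
have invl w : pres_eq (w^-1 * w) 1.
  by rewrite -{2}(invgK w); apply: pres_eq_inv.
move=> uv; apply: (@pres_eq_trans _ (u^-1 * (v * v^-1))).
  rewrite -{1}[u^-1]mulg1; apply: pres_eq_mul (pres_eq_refl _) _.
  exact/pres_eq_sym/pres_eq_inv.
rewrite mulgA -{2}[v^-1]mul1g; apply: pres_eq_mul (pres_eq_refl _).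
apply: pres_eq_trans (invl u).
by apply: pres_eq_mul (pres_eq_refl _) (pres_eq_sym uv).
Qed.

Definition presented : Type := {eq_quot pres_equiv}.
HB.instance Definition _ := Choice.on presented.
HB.instance Definition _ := Quotient.on presented.

Lemma presentedP (u v : word) :
  \pi_presented u = \pi_presented v <-> pres_eq u v.
Proof.
by split=> [/eqquotP/asboolP | uv] //; apply/eqquotP/asboolP.
Qed.

Definition presented_one : presented := \pi_presented (1 : word).
Definition presented_mul (g h : presented) : presented :=
  \pi_presented (repr g * repr h : word).
Definition presented_inv (g : presented) : presented :=
  \pi_presented ((repr g : word)^-1).

Lemma pres_eq_repr u : pres_eq (repr (\pi_presented u)) u.
Proof. by apply/presentedP; rewrite reprK. Qed.

Lemma presented_mulE (u v : word) :
  presented_mul (\pi_presented u) (\pi_presented v) =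
  \pi_presented (u * v : word).
Proof. by apply/presentedP; apply: pres_eq_mul; apply: pres_eq_repr. Qed.

Lemma presented_invE (u : word) :
  presented_inv (\pi_presented u) = \pi_presented (u^-1 : word).
Proof. by apply/presentedP/pres_eq_winv/pres_eq_repr. Qed.

Lemma presented_mulA : associative presented_mul.
Proof.
move=> g h k; elim/quotW: g => u; elim/quotW: h => v; elim/quotW: k => w.
by rewrite (presented_mulE v w) (presented_mulE u v) !presented_mulE mulgA.
Qed.

Lemma presented_mul1 : left_id presented_one presented_mul.
Proof. by move=> g; elim/quotW: g => u; rewrite presented_mulE mul1g. Qed.

Lemma presented_mulr1 : right_id presented_one presented_mul.
Proof. by move=> g; elim/quotW: g => u; rewrite presented_mulE mulg1. Qed.

Lemma presented_mulV : left_inverse presented_one presented_inv presented_mul.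
Proof.
move=> g; elim/quotW: g => u; rewrite presented_invE presented_mulE.
apply/presentedP.
by rewrite -{2}(invgK u); apply: pres_eq_inv.
Qed.

Lemma presented_mulrV : right_inverse presented_one presented_inv presented_mul.
Proof.
move=> g; elim/quotW: g => u; rewrite presented_invE presented_mulE.
apply/presentedP.
exact: pres_eq_inv.
Qed.

HB.instance Definition _ := isGroup.Build presented
  presented_mulA presented_mul1 presented_mulr1 presented_mulV presented_mulrV.

End Words.

Definition expgz (G : baseGroupType) (x : G) (z : int) : G :=
  match z with
  | Posz k => x ^+ k
  | Negz k => x ^- k.+1
  end.

Section TwistedConjugacy.
Variable G : groupType.

Definition twisted_conj (phi : G -> G) (g h : G) : Prop :=
  exists z : G, z * g * (phi z)^-1 = h.

Definition twisted_classes (phi : G -> G) : set (set G) :=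
  [set [set h | twisted_conj phi g h] | g in [set: G]]%classic.

End TwistedConjugacy.

Definition R_infinity (G : groupType) : Prop :=
  forall phi : {multiplicative G -> G},
    bijective phi -> infinite_set (twisted_classes phi).

Definition gen_a : word 'I_3 := letter (@Ordinal 3 0 isT).
Definition gen_t : word 'I_3 := letter (@Ordinal 3 1 isT).
Definition gen_s : word 'I_3 := letter (@Ordinal 3 2 isT).

Definition ats_group (n m : nat) (r : int) : groupType :=
  presented
    [:: (gen_t * gen_a * gen_t^-1, gen_a ^+ n);
        (gen_s * gen_a * gen_s^-1, gen_a ^+ m);
        (gen_t * gen_s * gen_t^-1 * gen_s^-1, expgz gen_a r)].

(* Main.v *)
Require Import Defs.
From HB Require Import structures.
From mathcomp Require Import all_boot all_order all_algebra.
From mathcomp Require Import boolp classical_sets functions cardinality.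
From mathcomp Require Import ring.

(** G acts on the line by affine maps, and the slopes of its elements turn out
to be preserved by every automorphism; the slope is then an invariant of
twisted conjugacy with infinitely many values.

The action is on the rational line, with positive slopes: a acts as
x |-> x + 1, t as x |-> n x, and s as x |-> m x + c, where the third relation
holds exactly when (n - 1) c = r (lemma [ats_affine_rep]). Write rho for this
action and consider, more generally, an arbitrary homomorphism psi from G to
the affine group with non-commutative image. Comparing slopes in
t a t^-1 = a^n gives k = k^n for the slope k > 0 of psi(a), hence k = 1, so
psi(a) is a translation. It is not the identity, since psi would otherwise
factor through G/<<a>>, where t and s commute. As conjugation by an affine map
multiplies a translation length by the slope, the relations t a t^-1 = a^n and
s a s^-1 = a^m force the slopes of psi(t) and psi(s) to be n and m. The slope
therefore does not depend on psi (lemma [slope_rigid]).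

If phi is an automorphism, rho o phi has the same non-commutative image as
rho, so slope (rho (phi g)) = slope (rho g) for all g. As slopes commute,
slope o rho is constant on the twisted conjugacy classes of phi; it takes the
pairwise distinct values n^k on the elements t^k
(lemma [infinite_twisted_classes]). *)

Set Implicit Arguments.
Unset Strict Implicit.
Unset Printing Implicit Defensive.

Import Order.TTheory GRing.Theory Num.Theory.

Local Open Scope group_scope.

(** * Homomorphisms out of a presented group *)

Lemma gmulf_expgz (U V : starMonoidType) (f : UMagmaMorphism.type U V) :
  {morph f : x / x^-1} -> forall x z, f (expgz x z) = expgz (f x) z.
Proof. by move=> fV x [] k /=; rewrite ?fV gmulfXn. Qed.

(** Induction on words by multiplication on the left by generators and their
inverses, which hides the encoding of words as lists. *)
Lemma word_elim (X : choiceType) (P : word X -> Prop) :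
    P 1 -> (forall x u, P u -> P (letter x * u)) ->
    (forall x u, P u -> P ((letter x)^-1 * u)) ->
  forall u, P u.
Proof.
move=> P1 PM PV; elim=> [|[x b] u IHu]; first exact: P1.
by case: b; [apply: (PV x) | apply: (PM x)].
Qed.

Section PresentedGroups.
Variables (X : choiceType) (rels : seq (word X * word X)).

Definition pres_class (u : word X) : presented rels :=
  (\pi_(presented rels) u)%qT.

Lemma pres_class_morphism : monoid.monoid_morphism pres_class.
Proof. by split=> [|u v]; last exact: esym (presented_mulE rels u v). Qed.

HB.instance Definition _ :=
  isUMagmaMorphism.Build (word X) (presented rels) pres_class
    pres_class_morphism.

Lemma pres_classV : {morph pres_class : u / u^-1}.
Proof. by move=> u; exact: esym (presented_invE rels u). Qed.

Lemma pres_class_rel u v : (u, v) \in rels -> pres_class u = pres_class v.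
Proof. by move=> uv; apply/presentedP/pres_eq_rel. Qed.

Lemma presented_ind (P : presented rels -> Prop) :
    P 1 -> (forall g h, P g -> P h -> P (g * h)) ->
    (forall g, P g -> P g^-1) -> (forall x, P (pres_class (letter x))) ->
  forall g, P g.
Proof.
move=> P1 PM PV Px; elim/quotW => u; rewrite -[(\pi u)%qT]/(pres_class u).
elim/word_elim: u => [|x u IHu|x u IHu]; first by rewrite gmulf1.
  by rewrite gmulfM; apply: PM.
by rewrite gmulfM /= pres_classV; apply: PM => //; apply: PV.
Qed.

(** The centralizer of an element is a subgroup, so commutation of the images
of the generators extends first to one argument and then to the other. *)
Lemma presented_commute (H : groupType)
    (f : UMagmaMorphism.type (presented rels) H) :
    (forall x y, commute (f (pres_class (letter x)))
                         (f (pres_class (letter y)))) ->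
  forall g h, commute (f g) (f h).
Proof.
move=> fX g h; elim/presented_ind: h => [|h k|h|y].
- by rewrite gmulf1; apply: commute1.
- by rewrite gmulfM; apply: commuteM.
- by rewrite gmulfV; apply: commuteV.
apply: commute_sym; elim/presented_ind: g => [|h k|h|x].
- by rewrite gmulf1; apply: commute1.
- by rewrite gmulfM; apply: commuteM.
- by rewrite gmulfV; apply: commuteV.
exact: fX.
Qed.

Section Lift.
Variables (H : groupType) (f : X -> H).

Definition word_eval (u : word X) : H :=
  \prod_(l <- u) (if l.2 then (f l.1)^-1 else f l.1).

Lemma word_eval_morphism : monoid.monoid_morphism word_eval.
Proof. by split=> [|u v]; rewrite /word_eval ?big_nil ?big_cat. Qed.

HB.instance Definition _ :=
  isUMagmaMorphism.Build (word X) H word_eval word_eval_morphism.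

Lemma word_eval_letter x : word_eval (letter x) = f x.
Proof. by rewrite /word_eval big_seq1. Qed.

Lemma word_eval_letterV x : word_eval (letter x)^-1 = (f x)^-1.
Proof. by rewrite /word_eval big_seq1. Qed.

Lemma word_evalV : {morph word_eval : u / u^-1}.
Proof.
elim/word_elim => [|x u IHu|x u IHu]; first by rewrite invg1 gmulf1 invg1.
  by rewrite invgM !gmulfM /= invgM IHu word_eval_letterV word_eval_letter.
rewrite invgM invgK !gmulfM /= invgM IHu word_eval_letterV word_eval_letter.
by rewrite invgK.
Qed.

Hypothesis f_rels :
  forall u v, (u, v) \in rels -> word_eval u = word_eval v.

Lemma word_eval_pres_eq u v : pres_eq rels u v -> word_eval u = word_eval v.
Proof.
elim=> {u v} [u v|u|u u' v v' _ IHu _ IHv|//|//|u v w _ -> _ //].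
- exact: f_rels.
- by rewrite gmulfM /= word_evalV mulgV gmulf1.
by rewrite !gmulfM /= IHu IHv.
Qed.

(** Von Dyck's theorem: a map on the generators that respects the relations
extends to a homomorphism, because the pairs of words with equal values form a
congruence whose quotient is a group. *)
Lemma presented_lift :
  exists g : UMagmaMorphism.type (presented rels) H,
    forall x, g (pres_class (letter x)) = f x.
Proof.
pose g (c : presented rels) := word_eval (repr c).
have gE u : g (pres_class u) = word_eval u.
  by apply: word_eval_pres_eq; apply: pres_eq_repr.
have gP : monoid.monoid_morphism g.
  split=> [|c d]; first by rewrite [LHS](gE 1) gmulf1.
  elim/quotW: c => u; elim/quotW: d => v.
  rewrite -[(\pi u)%qT]/(pres_class u) -[(\pi v)%qT]/(pres_class v).
  by rewrite -gmulfM /= !gE gmulfM.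
pose gI := isUMagmaMorphism.Build _ _ g gP.
pose gM : UMagmaMorphism.type (presented rels) H := HB.pack g gI.
by exists gM => x; rewrite -(word_eval_letter x) -gE.
Qed.

End Lift.
End PresentedGroups.

(** * The affine group of the rational line *)

(** The pair (k, c) with k > 0 stands for the map x |-> k x + c, and the group
law below is composition of maps. Restricting to positive slopes leaves 1 as
the only slope of finite order. *)
Definition affine : Type := {p : rat * rat | (0 < p.1)%R}.
HB.instance Definition _ := Choice.on affine.

Definition slope (x : affine) : rat := (sval x).1.
Definition shift (x : affine) : rat := (sval x).2.

Section AffineGroup.
Local Open Scope ring_scope.
Implicit Types x y z : affine.

Lemma slope_gt0 x : 0 < slope x. Proof. by case: x. Qed.

Lemma slope_neq0 x : slope x != 0.
Proof. exact/lt0r_neq0/slope_gt0. Qed.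

Lemma affineP x y : slope x = slope y -> shift x = shift y -> x = y.
Proof.
by move: x y => [[k c] ?] [[l d] ?] kl cd; apply: val_inj; congr pair.
Qed.

Definition Affine (k c : rat) (k_gt0 : 0 < k) : affine :=
  exist (fun p : rat * rat => 0 < p.1) (k, c) k_gt0.

Lemma slope_Affine k c (k_gt0 : 0 < k) : slope (Affine c k_gt0) = k.
Proof. by []. Qed.
Lemma shift_Affine k c (k_gt0 : 0 < k) : shift (Affine c k_gt0) = c.
Proof. by []. Qed.
Definition AffineE := (slope_Affine, shift_Affine).

Definition affine_one : affine := Affine 0 ltr01.
Definition affine_mul x y : affine :=
  Affine (shift x + slope x * shift y) (mulr_gt0 (slope_gt0 x) (slope_gt0 y)).

Lemma slopeV_gt0 x : 0 < (slope x)^-1.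
Proof. by rewrite invr_gt0 slope_gt0. Qed.

Definition affine_inv x : affine :=
  Affine (- ((slope x)^-1 * shift x)) (slopeV_gt0 x).

Lemma affine_mulA : associative affine_mul.
Proof. by move=> x y z; apply: affineP; rewrite !AffineE; ring. Qed.

Lemma affine_mul1 : left_id affine_one affine_mul.
Proof. by move=> x; apply: affineP; rewrite !AffineE; ring. Qed.

Lemma affine_mulr1 : right_id affine_one affine_mul.
Proof. by move=> x; apply: affineP; rewrite !AffineE; ring. Qed.

Lemma affine_mulV : left_inverse affine_one affine_inv affine_mul.
Proof.
by move=> x; apply: affineP; rewrite !AffineE ?addNr ?mulVf ?slope_neq0.
Qed.

Lemma affine_mulrV : right_inverse affine_one affine_inv affine_mul.
Proof.
move=> x; apply: affineP; rewrite !AffineE; first by rewrite divff ?slope_neq0.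
by rewrite mulrN mulrA divff ?slope_neq0 // mul1r subrr.
Qed.

HB.instance Definition _ := isGroup.Build affine
  affine_mulA affine_mul1 affine_mulr1 affine_mulV affine_mulrV.

Lemma slopeM x y : slope (x * y)%g = slope x * slope y. Proof. by []. Qed.
Lemma shiftM x y : shift (x * y)%g = shift x + slope x * shift y.
Proof. by []. Qed.
Lemma slopeV x : slope x^-1%g = (slope x)^-1. Proof. by []. Qed.
Lemma shiftV x : shift x^-1%g = - ((slope x)^-1 * shift x). Proof. by []. Qed.

Lemma slopeX x k : slope (x ^+ k)%g = slope x ^+ k.
Proof. by elim: k => [//|k IHk]; rewrite expgS slopeM IHk exprS. Qed.

Lemma shiftX x k : slope x = 1 -> shift (x ^+ k)%g = k%:R * shift x.
Proof.
move=> x1; elim: k => [|k IHk]; first by rewrite mul0r.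
by rewrite expgS shiftM IHk x1 -natr1; ring.
Qed.

Lemma slope_expgz x (z : int) : slope x = 1 -> slope (expgz x z) = 1.
Proof.
by move=> x1; case: z => k; rewrite /= ?slopeV slopeX x1 expr1n ?invr1.
Qed.

Lemma shift_expgz x (z : int) :
  slope x = 1 -> shift (expgz x z) = z%:~R * shift x.
Proof.
move=> x1; case: z => k; rewrite /= ?shiftV ?slopeX shiftX // x1 expr1n.
by rewrite invr1 mul1r NegzE intrN mulNr.
Qed.

End AffineGroup.

(** * Infinitely many twisted conjugacy classes *)

(** An invariant of twisted conjugacy with infinitely many values yields
infinitely many classes; the values may lie in any type. *)
Lemma infinite_twisted_classes (G : groupType) (phi : G -> G) (T : Type)
    (chi : G -> T) (x : nat -> G) :
    (forall z g, chi (z * g * (phi z)^-1) = chi g) ->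
    injective (chi \o x) ->
  infinite_set (twisted_classes phi).
Proof.
move=> chiP chi_inj.
pose cl k : set G := [set h | twisted_conj phi (x k) h]%classic.
have cl_inj : {in [set: nat]%classic &, injective cl}.
  move=> j k _ _ cl_jk; apply: chi_inj => /=.
  (* If the two classes agree, the twisted conjugate of x j by 1 lies in both,
     so chi takes there its values at x j and at x k. *)
  have : cl j (1 * x j * (phi 1)^-1) by exists 1.
  by rewrite cl_jk => -[z eqz]; rewrite -(chiP 1 (x j)) -eqz chiP.
apply/infiniteP; rewrite -(card_le_eql (inj_card_eq cl_inj)).
apply: subset_card_le => _ [k _ <-].
by exists (x k).
Qed.

(** * Affine representations of G *)

Section RigidSlope.
Variables (n m : nat) (r : int).
Hypotheses (n_ge2 : (2 <= n)%N) (m_gt0 : (0 < m)%N).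

Local Notation G := (ats_group n m r).
Local Notation rels :=
    [:: (gen_t * gen_a * gen_t^-1, gen_a ^+ n);
        (gen_s * gen_a * gen_s^-1, gen_a ^+ m);
        (gen_t * gen_s * gen_t^-1 * gen_s^-1, expgz gen_a r)].
Local Notation a := (pres_class rels gen_a : G).
Local Notation t := (pres_class rels gen_t : G).
Local Notation s := (pres_class rels gen_s : G).

Lemma ats_generators (P : 'I_3 -> Prop) :
  P (@Ordinal 3 0 isT) -> P (@Ordinal 3 1 isT) -> P (@Ordinal 3 2 isT) ->
  forall i, P i.
Proof.
by move=> P0 P1 P2 [[|[|[|i]]] lti] //; rewrite (bool_irrelevance lti isT).
Qed.

Lemma ats_rel_ta : t * a * t^-1 = a ^+ n.
Proof.
rewrite -pres_classV -!gmulfM -gmulfXn; apply: pres_class_rel.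
by rewrite !inE eqxx.
Qed.

Lemma ats_rel_sa : s * a * s^-1 = a ^+ m.
Proof.
rewrite -pres_classV -!gmulfM -gmulfXn; apply: pres_class_rel.
by rewrite !inE eqxx orbT.
Qed.

Lemma ats_rel_ts : t * s * t^-1 * s^-1 = expgz a r.
Proof.
rewrite -(gmulf_expgz (@pres_classV _ _)) -!pres_classV -!gmulfM.
by apply: pres_class_rel; rewrite !inE eqxx !orbT.
Qed.

Section Image.
Local Open Scope ring_scope.
Variable psi : UMagmaMorphism.type G affine.

Lemma affine_rep_ta : (psi t * psi a = psi a ^+ n * psi t)%g.
Proof. by rewrite -gmulfXn -ats_rel_ta !gmulfM gmulfV mulgVK. Qed.

Lemma affine_rep_sa : (psi s * psi a = psi a ^+ m * psi s)%g.
Proof. by rewrite -gmulfXn -ats_rel_sa !gmulfM gmulfV mulgVK. Qed.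

Lemma affine_rep_ts : (psi t * psi s = expgz (psi a) r * psi s * psi t)%g.
Proof.
rewrite -(gmulf_expgz (gmulfV psi)) -ats_rel_ts !gmulfM !gmulfV.
by rewrite !mulgVK.
Qed.

(** The slope k of psi a satisfies k = k ^ n, because slopes commute; as
n >= 2, the only positive solution is 1. *)
Lemma affine_rep_slope_a : slope (psi a) = 1.
Proof.
have n1_gt0 : (0 < n.-1)%N by rewrite -ltnS prednK // ltnW.
have a_ge0 := ltW (slope_gt0 (psi a)).
apply/eqP; rewrite -(pexpr_eq1 n1_gt0 a_ge0).
apply/eqP/(mulfI (slope_neq0 (psi a)))/(mulIf (slope_neq0 (psi t))).
rewrite -exprS prednK ?(ltnW n_ge2) // mulr1 -slopeX -slopeM -affine_rep_ta.
by rewrite slopeM mulrC.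
Qed.

(** A translation by 0 is trivial, so psi kills a and factors through the
quotient of G by the normal closure of a, which is the free abelian group on
t and s. *)
Lemma affine_rep_commute :
  shift (psi a) = 0 -> forall g h, commute (psi g) (psi h).
Proof.
move=> a0.
have a1 : psi a = 1%g by apply: affineP; rewrite ?affine_rep_slope_a ?a0.
have az1 : expgz (psi a) r = 1%g.
  by rewrite a1; case: r => k; rewrite /= expg1n ?invg1.
have cts : commute (psi t) (psi s) by rewrite /commute affine_rep_ts az1 mul1g.
have ca x : commute (psi a) x by rewrite a1; apply/commute_sym/commute1.
apply: presented_commute.
apply: ats_generators; apply: ats_generators => //;
  by [exact: ca | exact: commute_sym (ca _) | exact: commute_sym cts].
Qed.

(** Conjugating the non-trivial translation psi a by an affine map multiplies
its length by the slope of that map, while the relations multiply it by n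
for t and by m for s. *)
Lemma affine_rep_slope_ts :
    ~ (forall g h, commute (psi g) (psi h)) ->
  slope (psi t) = n%:R /\ slope (psi s) = m%:R.
Proof.
move=> ncomm.
have a0 : shift (psi a) != 0 by apply/eqP => /affine_rep_commute.
have a1 := affine_rep_slope_a.
have conj x k : (x * psi a = psi a ^+ k * x)%g -> slope x = k%:R.
  move=> /(congr1 shift); rewrite !shiftM slopeX a1 expr1n mul1r shiftX //.
  by rewrite addrC => /addIr /(mulIf a0).
by split; apply: conj; [apply: affine_rep_ta | apply: affine_rep_sa].
Qed.

End Image.

(** The slopes of the generators are the same for all representations with
non-commutative image. *)
Lemma slope_rigid (psi psi' : UMagmaMorphism.type G affine) :
    ~ (forall g h, commute (psi g) (psi h)) ->
    ~ (forall g h, commute (psi' g) (psi' h)) ->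
  forall g, slope (psi g) = slope (psi' g).
Proof.
move=> /affine_rep_slope_ts[t1 s1] /affine_rep_slope_ts[t2 s2].
elim/presented_ind => [|g h IHg IHh|g IHg|]; first by rewrite !gmulf1.
- by rewrite !gmulfM !slopeM IHg IHh.
- by rewrite !gmulfV !slopeV IHg.
by apply: ats_generators; rewrite ?affine_rep_slope_a ?t1 ?t2 ?s1 ?s2.
Qed.

Lemma ats_affine_rep : exists rho : UMagmaMorphism.type G affine,
  rho a = Affine 1 ltr01 /\ slope (rho t) = n%:R%R.
Proof.
have n_gt0 : (0 < n%:R :> rat)%R by rewrite ltr0n ltnW.
have mR_gt0 : (0 < m%:R :> rat)%R by rewrite ltr0n.
pose A : affine := Affine 1 ltr01.
pose T : affine := Affine 0 n_gt0.
(* The shift c of S solves (n - 1) c = r, which is what the third relation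
   imposes when t fixes 0. *)
pose S : affine := Affine (r%:~R / (n%:R - 1)) mR_gt0.
pose f (i : 'I_3) : affine := nth 1 [:: A; T; S] i.
have A1 : slope A = 1%R by [].
have n1 : (n%:R - 1 != 0 :> rat)%R by rewrite subr_eq0 pnatr_eq1 gtn_eqF.
have fV := word_evalV f.
have fl := word_eval_letter f.
have [u v|rho rhoE] := @presented_lift 'I_3 rels affine f.
  rewrite !inE => /or3P[] /eqP[-> ->]; apply/eqP.
  (* Cancelling the inverses on the right turns each relation into an equality
     between products of A, T and S. *)
  - rewrite !gmulfM gmulfXn /= fV !fl -(inj_eq (mulIg T)) mulgVK; apply/eqP.
    apply: affineP; rewrite ?slopeM ?shiftM slopeX ?shiftX //= !AffineE.
      by rewrite expr1n mulrC.
    by rewrite expr1n; ring.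
  - rewrite !gmulfM gmulfXn /= fV !fl -(inj_eq (mulIg S)) mulgVK; apply/eqP.
    apply: affineP; rewrite ?slopeM ?shiftM slopeX ?shiftX //= !AffineE.
      by rewrite expr1n mulrC.
    by rewrite expr1n; ring.
  rewrite !gmulfM (gmulf_expgz fV) /= !fV !fl.
  rewrite -(inj_eq (mulIg S)) mulgVK -(inj_eq (mulIg T)) mulgVK; apply/eqP.
  apply: affineP; rewrite ?slopeM ?shiftM ?slopeM slope_expgz ?shift_expgz //=.
    by rewrite !AffineE; ring.
  by rewrite !AffineE; field.
by exists rho; rewrite !rhoE.
Qed.

End RigidSlope.

Theorem proposition5p6 (n m : nat) (r : int) :
  (2 <= n)%N -> (2 <= m)%N -> coprime n m -> R_infinity (ats_group n m r).
Proof.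
move=> n_ge2 m_ge2 _ phi [phi' phiK phi'K].
have [rho [rhoa rhot]] := ats_affine_rep r n_ge2 (ltnW m_ge2).
have phi1 : phi 1 = 1 by apply: (mulgI (phi 1)); rewrite -gmulfM !mulg1.
have phiP : monoid.monoid_morphism phi by split; [|exact: gmulfM].
pose phiI := isUMagmaMorphism.Build _ _ phi phiP.
pose phiU : UMagmaMorphism.type (ats_group n m r) (ats_group n m r) :=
  HB.pack (Multiplicative.sort phi) phiI.
pose psi : UMagmaMorphism.type (ats_group n m r) affine := rho \o phiU.
have n_neq1 : (n%:R != 1 :> rat)%R by rewrite pnatr_eq1 gtn_eqF.
(* A translation commutes only with maps of slope 1, and t has slope n. *)
have rho_ncomm : ~ (forall g h, commute (rho g) (rho h)).
  move=> /(_ _ _) comm; have := comm (pres_class _ gen_t) (pres_class _ gen_a).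
  move=> /(congr1 shift); rewrite !shiftM rhoa rhot !AffineE mul1r mulr1.
  by rewrite addrC => /addIr /eqP; rewrite (negPf n_neq1).
(* phi is onto, so psi has the same image as rho. *)
have psi_ncomm : ~ (forall g h, commute (psi g) (psi h)).
  move=> comm; apply: rho_ncomm => g h; have := comm (phi' g) (phi' h).
  by rewrite /psi /= !phi'K.
have slope_phi g : slope (rho (phi g)) = slope (rho g).
  exact: (slope_rigid n_ge2 psi_ncomm rho_ncomm g).
apply: (@infinite_twisted_classes _ _ _ (slope \o rho)
          (fun k => pres_class _ gen_t ^+ k)).
  move=> z g /=; rewrite !gmulfM gmulfV !slopeM slopeV slope_phi.
  by rewrite mulrAC divff ?slope_neq0 // mul1r.
have n_gt0 : (0 < n%:R :> rat)%R by rewrite ltr0n ltnW.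
move=> j k /=; rewrite !gmulfXn !slopeX rhot.
exact: ieexprIn n_gt0 n_neq1 _ _.
Qed.
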